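(* Let $G=(\mathcal V,\mathcal E)$ be a connected, non-empty, finite graph without isolated vertices, with $N=|\mathcal V|$ nodes and centrality metric $v:\mathcal V\to(0,\infty)$. Then $$\lambda_1(G)\le\left(2N\,\frac{v_+^2}{v_-}\right)h_v(G),$$ where $v_-=\min_{i\in\mathcal V}v(i)$ and $v_+=\max_{i\in\mathcal V}v(i)$.
   Context: $G$ is undirected with adjacency matrix $\mathbf A$ ($a_{i,j}=1$ if $(i,j)\in\mathcal E$, else $0$). A centrality metric assigns to each node $i$ a number $v(i)$; $\mathbf V=\mathrm{diag}(v(i))$ and $\mathbf M_G=\mathbf V^{-1}\mathbf A$ is the Markov averaging operator. The normalized spectral gap $\lambda_1(G)$ is the smallest non-zero eigenvalue of $\mathbf I-\mathbf M_G$. For $U\subset\mathcal V$ let $|U|_v=\sum_{i\in U}v(i)$, and let $|\partial U|$ be the number of vertices that are connected to a vertex in $U$ but are not in $U$. The centrality-based Cheeger constant is $$h_v(G)=\min\left\{\frac{|\partial U|}{|U|_v}\;:\;\emptyset\ne U\subset\mathcal V,\ |U|_v\le\tfrac12|\mathcal V|_v\right\}.$$ *)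

(* Defs.v *)
From mathcomp Require Import all_boot all_order all_algebra.

Set Implicit Arguments.
Unset Strict Implicit.
Unset Printing Implicit Defensive.

Import Order.TTheory GRing.Theory Num.Theory.

Local Open Scope ring_scope.

(* An undirected graph is a symmetric relation e on a finite type T of nodes,
   and a centrality metric is a function v : T -> R. Self-loops are not
   excluded: they only contribute to the diagonal of the adjacency matrix. *)

Definition connected_graph (T : finType) (e : rel T) : Prop :=
  forall x y : T, connect e x y.

(* A loop at i does not prevent i from being isolated. *)
Definition isolated (T : finType) (e : rel T) (i : T) : bool :=
  [forall j, (j != i) ==> ~~ e i j].

(* Rows and columns are indexed by the nodes through enum_val. *)
Definition adjacency_mx (R : nzRingType) (T : finType) (e : rel T) :
    'M[R]_#|T| :=
  \matrix_(i, j) (e (enum_val i) (enum_val j))%:R.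

Definition centrality_mx (R : nzRingType) (T : finType) (v : T -> R) :
    'M[R]_#|T| :=
  diag_mx (\row_i v (enum_val i)).

Definition markov_mx (R : rcfType) (T : finType) (e : rel T) (v : T -> R) :
    'M[R]_#|T| :=
  invmx (centrality_mx v) *m adjacency_mx R e.

Definition is_min (R : rcfType) (P : R -> Prop) (m : R) : Prop :=
  P m /\ forall x, P x -> m <= x.

(* [eigenvalue] is defined through row vectors; a square matrix has the same
   eigenvalues on rows and on columns. For symmetric e and positive v the
   matrix is similar to a symmetric one, so no eigenvalue is lost by looking
   for them in the real closed field R. *)
Definition is_spectral_gap (R : rcfType) (T : finType) (e : rel T)
    (v : T -> R) (lambda1 : R) : Prop :=
  is_min (fun a => eigenvalue (1%:M - markov_mx e v) a /\ a != 0) lambda1.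

Definition volume (R : rcfType) (T : finType) (v : T -> R) (U : {set T}) : R :=
  \sum_(i in U) v i.

Definition boundary (T : finType) (e : rel T) (U : {set T}) : {set T} :=
  [set j | (j \notin U) && [exists i in U, e i j]].

Definition is_cheeger_constant (R : rcfType) (T : finType) (e : rel T)
    (v : T -> R) (h : R) : Prop :=
  is_min
    (fun r => exists U : {set T},
       [/\ U != set0, volume v U <= 2^-1 * volume v [set: T]
         & r = #|boundary e U|%:R / volume v U])
    h.

(* The node x0 only serves as a witness that T is non-empty: it is itself among
   the nodes i, so the extrema do not depend on it. *)
Definition min_centrality (R : rcfType) (T : finType) (x0 : T) (v : T -> R) :
    R :=
  \big[Num.min/v x0]_(i : T) v i.

Definition max_centrality (R : rcfType) (T : finType) (x0 : T) (v : T -> R) :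
    R :=
  \big[Num.max/v x0]_(i : T) v i.

(* Main.v *)
(* With D = V^(-1/2), the operator I - M is similar to the symmetric matrix
   S = I - D A D, hence diagonalizable with real eigenvalues, not all zero.
   If they are all nonnegative, the Perron-Frobenius argument shows that 0 has
   multiplicity at most one, so the smallest nonzero eigenvalue a satisfies
   a (N - 1) <= tr S <= N, whence a <= 2; if some eigenvalue is negative, a is
   negative.  On the other side, connectedness gives |dU| >= 1 for every
   admissible U, so that N v_+ h >= 2, and v_+ / v_- >= 1 concludes. *)

Require Import Defs.
From mathcomp Require Import all_boot all_order all_algebra.
From mathcomp Require Import complex ring lra.

Import Order.TTheory GRing.Theory Num.Theory.

Local Open Scope ring_scope.
Local Open Scope sesquilinear_scope.

(** * Diagonalization over [R[i]] and the kernel of [1%:M - B] *)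

Lemma mxrank_diag_le (F : fieldType) (n : nat) (d : 'rV[F]_n) :
  (\rank (diag_mx d) <= #|[set i | (d 0 i != 0)%R]|)%N.
Proof.
rewrite diag_mx_sum_delta -sum1_card.
rewrite (bigID (mem [set i | d 0 i != 0])) /= [X in (_ + X)%R]big1 ?addr0.
  elim/big_rec2: _ => [|i k A _ IH]; first by rewrite mxrank0.
  apply: leq_trans (mxrank_add _ _) _; apply: leq_add IH.
  by apply: leq_trans (mxrank_scale _ _) _; rewrite mxrank_delta.
by move=> i; rewrite inE negbK => /eqP->; rewrite scale0r.
Qed.

Section RealDiagonal.

Variables (R : rcfType) (n : nat) (A : 'M[R]_n) (d : 'rV[R]_n).
(** The change of basis lives over [R[i]], where the spectral theorem applies, while the spectrum
    [d] is real. Rank, trace and invertibility survive the field extension, so their values can be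
    brought back to [R]. *)
Variable Q : 'M[R[i]]_n.
Hypothesis Q_unit : Q \in unitmx.
Let toC := real_complex R.
Hypothesis A_diag : map_mx toC A = invmx Q *m diag_mx (map_mx toC d) *m Q.

Lemma diag_mxrank_le : (\rank A <= #|[set i | (d 0 i != 0)%R]|)%N.
Proof.
rewrite -(mxrank_map toC) A_diag -map_diag_mx.
apply: leq_trans (mxrankM_maxl _ _) _; apply: leq_trans (mxrankM_maxr _ _) _.
by rewrite mxrank_map mxrank_diag_le.
Qed.

Lemma diag_trace : \tr A = \sum_i d 0 i.
Proof.
apply: (@complexI R); rewrite -[LHS](@trace_map_mx _ _ toC) A_diag.
rewrite mxtrace_mulC mulmxA mulmxV // mul1mx mxtrace_diag raddf_sum /=.
by apply: eq_bigr => i _; rewrite mxE.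
Qed.

(** Being an eigenvalue means that [A - a%:M] is singular; over [R[i]] this says that the product of
    the [d 0 i - a] has a zero factor. *)
Lemma diag_eigenvalue (a : R) : eigenvalue A a = [exists i, d 0 i == a].
Proof.
rewrite /eigenvalue /eigenspace kermx_eq0 row_free_unit.
rewrite -(map_unitmx toC) map_mxB map_scalar_mx A_diag.
have -> : (toC a)%:M = invmx Q *m (toC a)%:M *m Q.
  by rewrite mul_mx_scalar -scalemxAl mulVmx // scalemx1.
rewrite -mulmxBl -mulmxBr !unitmx_mul unitmx_inv Q_unit /= andbT.
rewrite -diag_const_mx -raddfB /= unitmxE unitfE det_diag.
rewrite prodf_seq_neq0 -has_predC; apply/hasP/existsP => [[i _]|[i /eqP di]].
  rewrite /= negbK !mxE subr_eq0 => /eqP/(@complexI R) di.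
  by exists i; rewrite di.
by exists i; rewrite ?mem_index_enum //= negbK !mxE di subrr.
Qed.

End RealDiagonal.

(** A real symmetric matrix is Hermitian over [R[i]], so its spectrum is real and equals its own
    real part, which serves as [d]. *)
Lemma real_sym_unitary_diag (R : rcfType) (n : nat) (S : 'M[R]_n) :
  S^T = S ->
  exists (P : 'M[R[i]]_n) (d : 'rV[R]_n), P \is unitarymx /\
    map_mx (real_complex R) S
      = invmx P *m diag_mx (map_mx (real_complex R) d) *m P.
Proof.
move=> symS; pose SC := map_mx (real_complex R) S.
have hermS : SC \is hermsymmx.
  apply: realsym_hermsym; last first.
    by apply/mxOverP => i j; rewrite mxE; apply/complex_realP; exists (S i j).
  by apply/is_hermitianmxP; rewrite expr0 scale1r map_mx_id // /SC map_trmx symS.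
have /hermitian_spectral_diag_real/mxOverP dR := hermS.
have /hermitian_normalmx/orthomx_spectralP Sdiag := hermS.
exists (spectralmx SC), (map_mx (@complex.Re R) (spectral_diag SC)).
split; first exact: spectral_unitarymx.
rewrite -/SC {1}Sdiag; congr (_ *m diag_mx _ *m _).
by apply/rowP => i; rewrite !mxE [LHS]/= -[LHS]RRe_real.
Qed.

(** In the coordinates [w] of [f] in the eigenbasis, the quadratic form is the sum of the $d_i
    |w_i|^2$. These terms are nonnegative with sum at most 0, so every $d_i w_i$ vanishes. *)
Lemma psd_isotropic_ker (R : rcfType) (n : nat) (S : 'M[R]_n)
    (P : 'M[R[i]]_n) (d : 'rV[R]_n) (f : 'rV[R]_n) :
  P \is unitarymx ->
  map_mx (real_complex R) S
    = invmx P *m diag_mx (map_mx (real_complex R) d) *m P ->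
  (forall i, 0 <= d 0 i) ->
  (f *m S *m f^T) 0 0 <= 0 -> f *m S = 0.
Proof.
move=> P_unitary Sdiag d_ge0 fSf; pose toC := real_complex R.
pose w := map_mx toC f *m P^t*.
have fSf_sum : toC ((f *m S *m f^T) 0 0) =
    \sum_i toC (d 0 i) * `|w 0 i| ^+ 2.
  have -> : toC ((f *m S *m f^T) 0 0) =
      (map_mx toC (f *m S *m f^T)) 0 0 by rewrite [RHS]mxE.
  rewrite !map_mxM Sdiag invmx_unitary // !mulmxA -/w -mulmxA.
  have -> : P *m map_mx toC f^T = w^t*.
    rewrite /w trmx_mul map_mxM trmxCK; congr (_ *m _).
    by apply/matrixP => i j; rewrite !mxE [RHS]conjc_real.
  rewrite mul_mx_diag mxE; apply: eq_bigr => i _.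
  by rewrite !mxE normCK -!mulrA mulrCA.
have term_ge0 i : 0 <= toC (d 0 i) * `|w 0 i| ^+ 2.
  by rewrite mulr_ge0 ?exprn_ge0 // ler0c.
have /eqP sum0 : \sum_i toC (d 0 i) * `|w 0 i| ^+ 2 == 0.
  rewrite eq_le sumr_ge0 // andbT -fSf_sum.
  by have := fSf; rewrite -(lecR _ 0).
have wD0 : w *m diag_mx (map_mx toC d) = 0.
  rewrite mul_mx_diag; apply/rowP => i.
  rewrite [LHS]mxE [RHS]mxE [X in _ * X]mxE.
  have /eqP := sum0; rewrite psumr_eq0 // => /allP /(_ i).
  rewrite mem_index_enum => /(_ isT); rewrite mulf_eq0 expf_eq0 /= normr_eq0.
  by case/orP => /eqP ->; rewrite ?mulr0 ?mul0r.
apply/eqP; rewrite -(map_mx_eq0 toC); apply/eqP.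
by rewrite map_mxM Sdiag invmx_unitary // !mulmxA -/w wD0 mul0mx.
Qed.

(* Perron-Frobenius: |f| is again isotropic when f is, and a nonnegative
   kernel vector vanishing at one node vanishes at its neighbours. *)
Lemma perron_ker_rank (R : rcfType) (n : nat) (B : 'M[R]_n) :
  (forall i j, 0 <= B i j) ->
  (forall i j, connect [rel i j | 0 < B i j] i j) ->
  (forall f : 'rV[R]_n,
     (f *m (1%:M - B) *m f^T) 0 0 <= 0 -> f *m (1%:M - B) = 0) ->
  (\rank (kermx (1%:M - B)) <= 1)%N.
Proof.
move=> B_ge0 B_conn isotropic.
case: n B B_ge0 B_conn isotropic => [|n] B B_ge0 B_conn isotropic.
  by rewrite (leq_trans (rank_leq_row _)).
have quadE (f : 'rV[R]_n.+1) : (f *m (1%:M - B) *m f^T) 0 0 =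
    \sum_i f 0 i ^+ 2 - \sum_i \sum_j f 0 j * B j i * f 0 i.
  rewrite mulmxBr mulmx1 mulmxBl !mxE; congr (_ - _).
    by apply: eq_bigr => i _; rewrite mxE expr2.
  by apply: eq_bigr => i _; rewrite !mxE big_distrl.
(* Evaluation at node 0 has rank at most 1, so it is enough that a kernel vector vanishing at node 0
   is zero. *)
rewrite -(mxrank_mul_ker _ (delta_mx 0 0 : 'cV_n.+1)).
suff -> : (kermx (1%:M - B) :&: kermx (delta_mx 0 0 : 'cV_n.+1))%MS = 0.
  by rewrite mxrank0 addn0 rank_leq_col.
apply/eqP/rowV0P => f; rewrite sub_capmx !sub_kermx => /andP[/eqP fS /eqP f0].
pose g := map_mx Num.norm f.
have gS : g *m (1%:M - B) = 0.
  apply: isotropic.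
  (* Absolute values keep the sum of squares and, as [B] is nonnegative, can only increase the
     subtracted double sum. *)
  apply: le_trans (_ : (f *m (1%:M - B) *m f^T) 0 0 <= 0); last first.
    by rewrite fS mul0mx mxE.
  rewrite !quadE lerB //.
    by apply: ler_sum => i _; rewrite mxE real_normK ?num_real.
  apply: ler_sum => i _; apply: ler_sum => j _; rewrite !mxE.
  rewrite -[B j i in leRHS]ger0_norm // -!normrM; exact: ler_norm.
have gE i : g 0 i = \sum_j g 0 j * B j i.
  have /rowP/(_ i)/eqP := gS.
  by rewrite mulmxBr mulmx1 !mxE subr_eq0 => /eqP.
have g0 : g 0 0 == 0.
  by have /colP/(_ 0) := f0; rewrite -colE !mxE => ->; rewrite normr0.
have g_step i j : 0 < B i j -> g 0 j == 0 -> g 0 i == 0.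
  move=> Bij /eqP gj; have := gE j; rewrite gj => /esym/eqP.
  rewrite psumr_eq0 => [/allP/(_ i)|k _]; last by rewrite mulr_ge0 // mxE.
  rewrite mem_index_enum => /(_ isT); rewrite mulf_eq0 => /orP[//|].
  by rewrite gt_eqF.
have g_path i p : path [rel i j | 0 < B i j] i p ->
    g 0 (last i p) == 0 -> g 0 i == 0.
  elim: p i => //= j p IH i /andP[Bij /IH jp] /jp; exact: g_step.
apply/rowP => i; rewrite mxE; apply/eqP; rewrite -normr_eq0.
have /connectP[p pathp lastp] := B_conn i 0.
by have := g_path _ _ pathp; rewrite -lastp => /(_ g0); rewrite mxE.
Qed.

(** * Volumes, boundaries and the Cheeger constant *)

Lemma volume_gt0 (R : rcfType) (T : finType) (v : T -> R) (U : {set T}) :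
  (forall i, 0 < v i) -> U != set0 -> 0 < volume v U.
Proof.
move=> v_gt0 /set0Pn[x xU]; rewrite /volume (bigD1 x) //=.
by rewrite ltr_wpDr // sumr_ge0 // => i _; rewrite ltW.
Qed.

(** With an empty boundary, a path that starts in [U] could never leave it, and paths reach every
    node. *)
Lemma boundary_gt0 (T : finType) (e : rel T) (U : {set T}) :
  connected_graph e -> U != set0 -> U != [set: T] -> (0 < #|boundary e U|)%N.
Proof.
move=> e_conn /set0Pn[x xU] UT; rewrite lt0n cards_eq0; apply: contraNneq UT.
move=> bd0; apply/eqP/setP => y; rewrite inE.
have /connectP[p ep ->] := e_conn x y.
elim: p x xU ep => //= z p IH x xU /andP[exz]; apply: IH.
apply: contraT => zU; have : z \in boundary e U.
  by rewrite inE zU; apply/existsP; exists x; rewrite xU.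
by rewrite bd0 inE.
Qed.

Lemma volume_le_max (R : rcfType) (T : finType) (x0 : T) (v : T -> R) :
  volume v [set: T] <= #|T|%:R * max_centrality x0 v.
Proof.
rewrite /volume mulr_natl -[X in _ *+ X]cardsT -sumr_const.
by apply: ler_sum => i _; apply: le_bigmax.
Qed.

Lemma cheeger_constant_exists (R : rcfType) (T : finType) (v : T -> R)
    (e : rel T) (x y : T) :
  (forall i, 0 < v i) -> x != y -> exists h, is_cheeger_constant e v h.
Proof.
move=> v_gt0 xy.
pose P (U : {set T}) :=
  (U != set0) && (volume v U <= 2^-1 * volume v [set: T]).
pose F (U : {set T}) := #|boundary e U|%:R / volume v U.
(* The volumes of [[set x]] and its complement add up to the total, so one of the two is at most
   half; [y] makes the complement non-empty. *)
have [U0 PU0] : exists U0, P U0.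
  have volC : volume v [set: T] = volume v [set x] + volume v (~: [set x]).
    rewrite /volume (bigID (mem [set x])) /=; congr (_ + _);
      by apply: eq_bigl => i; rewrite !inE.
  have [le1|gt1] := leP (volume v [set x]) (2^-1 * volume v [set: T]).
    by exists [set x]; rewrite /P le1 andbT; apply/set0Pn; exists x; rewrite inE.
  exists (~: [set x]); apply/andP; split.
    by apply/set0Pn; exists y; rewrite !inE eq_sym.
  have half (z : R) : z = 2^-1 * z + 2^-1 * z.
    by rewrite ![2^-1 * _]mulrC -splitr.
  rewrite -(lerD2l (volume v [set x])) -volC [leLHS]half lerD2r; exact: ltW.
pose U1 := [arg min_(U < U0 | P U) F U]%O.
exists (F U1); rewrite /U1; case: arg_minP => // U /andP[U_n0 U_half] U_min.
split; first by exists U.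
by move=> r [V [V_n0 V_half ->]]; apply: U_min; rewrite /P V_n0.
Qed.

Lemma cheeger_constant_ge (R : rcfType) (T : finType) (x0 : T) (v : T -> R)
    (e : rel T) (h : R) :
  (forall i, 0 < v i) -> connected_graph e -> is_cheeger_constant e v h ->
  2 <= (#|T|%:R * max_centrality x0 v) * h.
Proof.
move=> v_gt0 e_conn [[U [U_n0 U_half ->]] _].
have U_gt0 := volume_gt0 _ _ _ _ v_gt0 U_n0.
have U_nT : U != [set: T].
  apply: contraTneq U_half => UT; rewrite -ltNge UT gtr_pMl; last first.
    by rewrite -UT.
  by rewrite invf_lt1 ?ltr1n.
rewrite mulrA ler_pdivlMr //.
(* The chain is $2|U|_v \le |\mathcal V|_v \le N v_+ \le N v_+ |\partial U|$. *)
apply: le_trans (_ : volume v [set: T] <= _).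
  by rewrite mulrC -ler_pdivlMr // mulrC.
apply: le_trans (volume_le_max _ _ x0 v) _; rewrite ler_peMr //.
  apply: le_trans (volume_le_max _ _ x0 v).
  by rewrite /volume sumr_ge0 // => i _; rewrite ltW.
by rewrite ler1n boundary_gt0.
Qed.

Lemma min_le_max_centrality (R : rcfType) (T : finType) (x0 : T) (v : T -> R) :
  (forall i, 0 < v i) ->
  0 < min_centrality x0 v <= max_centrality x0 v.
Proof.
move=> v_gt0; apply/andP; split.
  by rewrite /min_centrality; elim/big_ind: _ => // a b a0 b0; rewrite lt_min a0.
apply: (@le_trans _ _ (v x0)); [exact: bigmin_le | exact: le_bigmax].
Qed.

(** * The spectral gap of the Markov operator *)

Section SpectralGap.

Variables (R : rcfType) (T : finType) (e : rel T) (v : T -> R).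
Hypotheses (e_undirected : symmetric e) (e_connected : connected_graph e).
Hypothesis v_gt0 : forall i, 0 < v i.

(** The matrix [diag_mx s] is $D = V^{-1/2}$, and [B] is $D A D$, the symmetric form of the Markov
    operator. *)
Let s : 'rV[R]_#|T| := \row_i (Num.sqrt (v (enum_val i)))^-1.
Let B : 'M[R]_#|T| :=
  \matrix_(i, j) (s 0 i * (e (enum_val i) (enum_val j))%:R * s 0 j).
Let L := 1%:M - markov_mx e v.

Let s_gt0 i : 0 < s 0 i.
Proof. by rewrite mxE invr_gt0 sqrtr_gt0. Qed.

Let diag_s_unit : diag_mx s \in unitmx.
Proof.
rewrite unitmxE det_diag unitfE prodf_seq_neq0; apply/allP => i _.
by rewrite /= gt_eqF.
Qed.

Let B_ge0 i j : 0 <= B i j.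
Proof. by rewrite mxE mulr_ge0 ?mulr_ge0 ?ler0n // ltW. Qed.

Let B_connected i j : connect [rel i j | 0 < B i j] i j.
Proof.
have /connectP[p] := e_connected (enum_val i) (enum_val j).
elim: p i => [|x p IH] i /=; first by move=> _ /enum_val_inj <-.
case/andP=> eix px jE; apply: (connect_trans (y := enum_rank x)).
  by apply: connect1; rewrite /= mxE enum_rankK eix mulr1 mulr_gt0.
by apply: IH; rewrite enum_rankK.
Qed.

Let symS : (1%:M - B)^T = 1%:M - B.
Proof.
apply/matrixP => i j; rewrite !mxE eq_sym e_undirected; ring.
Qed.

(** Since $V^{-1} = D D$, one has $V^{-1} A = D (D A D) D^{-1}$. *)
Let LE : L = diag_mx s *m (1%:M - B) *m invmx (diag_mx s).
Proof.
rewrite mulmxBr mulmx1 mulmxBl mulmxV //; congr (_ - _).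
apply: (can_inj (mulmxK diag_s_unit)); rewrite mulmxKV // /markov_mx.
have -> : invmx (centrality_mx v) = diag_mx s *m diag_mx s.
  have V1 : centrality_mx v *m (diag_mx s *m diag_mx s) = 1%:M.
    apply/matrixP => i j; rewrite !mul_diag_mx !mxE.
    have [->|ij] := eqVneq i j; last by rewrite !mulr0.
    rewrite !mulr1n -invfM -expr2 sqr_sqrtr; last exact: ltW.
    by rewrite mulfV // gt_eqF.
  have [V_unit _] := mulmx1_unit V1.
  by rewrite -[RHS](mulKmx V_unit) V1 mulmx1.
rewrite -!mulmxA; congr (_ *m _).
by apply/matrixP => i j; rewrite mul_diag_mx mul_mx_diag !mxE mulrA.
Qed.

Lemma spectral_gap_exists_le2 (x y : T) : x != y -> e x y ->
  exists2 a, is_spectral_gap e v a & a <= 2.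
Proof.
move=> xy exy; have [P [d [P_unitary Sdiag]]] := real_sym_unitary_diag R _ _ symS.
pose toC := real_complex R.
have P_unit := unitarymx_unit P_unitary.
pose Q := P *m map_mx toC (invmx (diag_mx s)).
have Q_unit : Q \in unitmx by rewrite unitmx_mul P_unit map_unitmx unitmx_inv.
have Ldiag : map_mx toC L = invmx Q *m diag_mx (map_mx toC d) *m Q.
  have -> : invmx Q = map_mx toC (diag_mx s) *m invmx P.
    apply: (can_inj (mulmxK Q_unit)); rewrite mulVmx // /Q !mulmxA mulmxKV //.
    by rewrite -map_mxM mulmxV // map_mx1.
  by rewrite LE !map_mxM Sdiag /Q !mulmxA.
(* If the spectrum were zero, [B] would be the identity, but the edge between the distinct nodes [x]
   and [y] gives a positive off-diagonal entry. *)
have [i0 di0] : exists i0, d 0 i0 != 0.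
  case: (pickP (fun i => d 0 i != 0)) => [i di|d0]; first by exists i.
  have dE : d = 0 by apply/rowP => i; rewrite mxE; have /negbFE/eqP := d0 i.
  have S0 : 1%:M - B == 0.
    rewrite -(map_mx_eq0 toC) Sdiag dE.
    by rewrite map_mx0 raddf0 mulmx0 mul0mx.
  have : 0 < B (enum_rank x) (enum_rank y).
    by rewrite mxE !enum_rankK exy mulr1 mulr_gt0.
  move: S0; rewrite subr_eq0 => /eqP <-.
  by rewrite mxE (inj_eq enum_rank_inj) (negbTE xy) ltxx.
pose i1 := [arg min_(i < i0 | d 0 i != 0) d 0 i]%O.
have [di1 i1_min] : d 0 i1 != 0 /\ forall i, d 0 i != 0 -> d 0 i1 <= d 0 i.
  by rewrite /i1; case: arg_minP.
exists (d 0 i1).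
  split=> [|a []]; rewrite (diag_eigenvalue R _ L d Q Q_unit Ldiag).
    by split=> //; apply/existsP; exists i1.
  by case/existsP => i /eqP <-; apply: i1_min.
(* If the smallest nonzero eigenvalue exceeds 2, none is negative, so the isotropy lemma and then
   the Perron-Frobenius bound apply. *)
rewrite leNgt; apply/negP => gap_gt2.
have d_ge0 i : 0 <= d 0 i.
  have [->//|/i1_min] := eqVneq (d 0 i) 0.
  by apply: le_trans; rewrite ltW // (lt_trans _ gap_gt2) ?ltr0n.
have := perron_ker_rank R _ B B_ge0 B_connected
  (fun f => psd_isotropic_ker R _ _ P d f P_unitary Sdiag d_ge0).
rewrite mxrank_ker leq_subLR => n_le_rank.
set k := #|[set i | (d 0 i != 0)%R]|.
(* The kernel has dimension at most 1, so all but at most one of the eigenvalues are nonzero. *)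
have n_le_k : (#|T| <= k + 1)%N.
  apply: leq_trans n_le_rank _.
  by rewrite leq_add2r (diag_mxrank_le R _ _ d P).
have k_gt0 : (0 < k)%N by apply/card_gt0P; exists i1; rewrite inE.
(* The diagonal of [B], which records the loops, is nonnegative and only lowers the trace. *)
have trace_le : \sum_i d 0 i <= #|T|%:R.
  rewrite -(diag_trace R _ _ d P P_unit Sdiag) raddfB /= mxtrace1 gerBl.
  by rewrite /mxtrace sumr_ge0.
have trace_ge : d 0 i1 * k%:R <= \sum_i d 0 i.
  rewrite mulr_natr -sumr_const big_mkcond /=; apply: ler_sum => i _.
  by rewrite inE; case: ifP => // /i1_min.
suff : d 0 i1 <= 2 by rewrite leNgt gap_gt2.
(* With $a$ the smallest nonzero eigenvalue, $a k \le N \le k + 1 \le 2 k$, the last step because $k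
   \ge 1$. *)
rewrite -(ler_pM2r (_ : 0 < k%:R)) ?ltr0n //.
apply: le_trans trace_ge (le_trans trace_le _).
by rewrite -natrM ler_nat (leq_trans n_le_k) // mul2n -addnn leq_add2l.
Qed.

End SpectralGap.

Theorem proposition3p3p4 (R : rcfType) (T : finType) (x0 : T) (e : rel T)
    (v : T -> R)
    (e_undirected : symmetric e)
    (e_connected : connected_graph e)
    (e_no_isolated : forall i : T, ~~ isolated e i)
    (v_gt0 : forall i : T, 0 < v i) :
  exists lambda1 h : R,
    [/\ is_spectral_gap e v lambda1,
        is_cheeger_constant e v h
      & lambda1 <=
          (2 * #|T|%:R *
             (max_centrality x0 v ^+ 2 / min_centrality x0 v)) * h].
Proof.
(* As loops do not count against isolation, the neighbour differs from [x0]; it serves both for a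
   nonzero eigenvalue and for an admissible set. *)
have [y yx0 ex0y] : exists2 y, y != x0 & e x0 y.
  have := e_no_isolated x0; rewrite negb_forall => /existsP[y].
  by rewrite negb_imply negbK => /andP[]; exists y.
have x0y : x0 != y by rewrite eq_sym.
have [a a_gap a_le2] :=
  spectral_gap_exists_le2 _ _ _ _ e_undirected e_connected v_gt0 _ _ x0y ex0y.
have [h h_cheeger] := cheeger_constant_exists R T v e _ _ v_gt0 x0y.
exists a, h; split => //; apply: le_trans a_le2 _.
have h_ge := cheeger_constant_ge _ _ x0 _ _ _ v_gt0 e_connected h_cheeger.
have /andP[min_gt0 min_max] := min_le_max_centrality R T x0 v v_gt0.
set M := max_centrality x0 v in h_ge min_max *.
set m := min_centrality x0 v in min_gt0 min_max *.
(* In this grouping $v_+/v_- \ge 1$ and $N v_+ h \ge 2$, so the right-hand side is at least 4. *)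
have -> : 2 * #|T|%:R * (M ^+ 2 / m) * h = 2 * (M / m) * (#|T|%:R * M * h).
  by field; rewrite gt_eqF.
have Mm : 1 <= M / m by rewrite ler_pdivlMr // mul1r.
nra.
Qed.
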